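(* Let $\Omega\subset\mathbb{R}^d$ be open and bounded and let $V$ be a real Banach space with topological dual $V^*$. Assume that $u\colon\Omega\to V$ is weakly measurable and $p\colon\Omega\to V^*$ is weakly* continuous, i.e., for each $v\in V$, the map $x\mapsto\langle p(x),v\rangle$ is continuous. Then the map $x\mapsto\langle p(x),u(x)\rangle$ is measurable.
   Context: $\langle q,v\rangle := q(v)$ for $q\in V^*$, $v\in V$. A function $u\colon\Omega\to V$ is weakly measurable if $x\mapsto\langle q,u(x)\rangle$ is measurable for each $q\in V^*$. Measurability on $\Omega$ is with respect to Lebesgue measure. *)

(* Defs.v *)
From HB Require Import structures.
From mathcomp Require Import all_boot all_order all_algebra.
From mathcomp Require Import all_classical all_reals all_analysis.
Import Order.TTheory GRing.Theory Num.Theory.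
Import numFieldNormedType.Exports.

Set Implicit Arguments.
Unset Strict Implicit.
Unset Printing Implicit Defensive.

Local Open Scope classical_set_scope.
Local Open Scope ring_scope.

(* Half-open boxes are represented by their corners; a box is empty, and has
   volume 0, when some b i <= a i. *)
Definition box (R : realType) (d : nat) (c : 'rV[R]_d * 'rV[R]_d)
    : set 'rV[R]_d :=
  [set x | forall i, x ord0 i \in `]c.1 ord0 i, c.2 ord0 i]].

Definition box_volume (R : realType) (d : nat) (c : 'rV[R]_d * 'rV[R]_d) : R :=
  \prod_(i < d) Num.max 0 (c.2 ord0 i - c.1 ord0 i).

(* The covering families are countable sets of boxes, not sequences, so that
   the empty family is allowed: in dimension 0 no box is empty. *)
Definition lebesgue_outer (R : realType) (d : nat) (A : set 'rV[R]_d)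
    : \bar R :=
  ereal_inf [set \esum_(c in C) (box_volume c)%:E |
    C in [set C : set ('rV[R]_d * 'rV[R]_d) |
      countable C /\ A `<=` \bigcup_(c in C) box c]].

Section lebesgue_outer_measure.
Context (R : realType) (d : nat).
Local Notation mu := (@lebesgue_outer R d).
Local Open Scope ereal_scope.

Lemma box_volume_ge0 (c : 'rV[R]_d * 'rV[R]_d) : (0 <= box_volume c)%R.
Proof. by apply: prodr_ge0 => i _; rewrite le_max lexx. Qed.

Lemma lebesgue_outer_ge0 A : 0 <= mu A.
Proof.
apply: le_ereal_inf_tmp => _ [C _ <-].
by apply: esum_ge0 => c _; rewrite lee_fin box_volume_ge0.
Qed.

Lemma lebesgue_outer0 : mu set0 = 0.
Proof.
apply/eqP; rewrite eq_le lebesgue_outer_ge0 andbT.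
by apply: ereal_inf_lbound; exists set0; [split|rewrite esum_set0].
Qed.

Lemma le_lebesgue_outer : {homo mu : A B / A `<=` B >-> A <= B}.
Proof.
move=> A B AB; apply/ereal_inf_le_tmp => _ [C [cC BC] <-].
by exists C => //; split => //; exact: subset_trans BC.
Qed.

Lemma lebesgue_outer_sigma_subadditive : sigma_subadditive mu.
Proof.
move=> A; have [[i ioo]|] := pselect (exists i, mu (A i) = +oo).
  rewrite (eseries_pinfty _ _ ioo) ?leey// => n _.
  by rewrite -ltNye (lt_le_trans _ (lebesgue_outer_ge0 _)).
rewrite -forallNE => Aoo.
suff add2e (e : {posnum R}) :
    mu (\bigcup_n A n) <= \sum_(i <oo) mu (A i) + e%:num%:E.
  by apply/lee_addgt0Pr => _/posnumP[].
rewrite (le_trans _ (epsilon_trick _ _ _))//; last first.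
  by move=> n; exact: lebesgue_outer_ge0.
pose P n (C : set ('rV[R]_d * 'rV[R]_d)) :=
  (countable C /\ A n `<=` \bigcup_(c in C) box c) /\
  \esum_(c in C) (box_volume c)%:E <= mu (A n) + (e%:num / (2 ^ n.+1)%:R)%:E.
have [G PG] : {G : (set ('rV[R]_d * 'rV[R]_d))^nat & forall n, P n (G n)}.
  apply: (@choice _ _ P) => n; rewrite /P.
  have fA : mu (A n) \is a fin_num.
    by rewrite ge0_fin_numE ?lebesgue_outer_ge0// ltey; apply/eqP/Aoo.
  have en0 : (0 < e%:num / (2 ^ n.+1)%:R)%R by [].
  have [_ [C CA <-] /ltW Ce] := lb_ereal_inf_adherent en0 fA.
  by exists C.
have vol0 c : 0 <= (@box_volume R d c)%:E by rewrite lee_fin box_volume_ge0.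
apply: (@le_trans _ _ (\sum_(i <oo) \esum_(c in G i) (box_volume c)%:E)).
  apply: (@le_trans _ _ (\esum_(c in \bigcup_n G n) (box_volume c)%:E)).
    apply: ereal_inf_lbound; exists (\bigcup_n G n) => //; split.
      by apply: bigcup_countable => // n _; exact: (PG n).1.1.
    move=> x [n _ /(PG n).1.2[c Gc xc]].
    by exists c => //; exists n.
  rewrite seqDU_bigcup_eq (esum_bigcupT _ _ (@trivIset_seqDU _ G) vol0).
  rewrite nneseries_esumT; last by move=> n; apply: esum_ge0 => c _.
  apply: le_esum => n _; rewrite [leRHS](esumID (seqDU G n))// setIidr.
    by rewrite leeDl//; apply: esum_ge0 => c _.
  exact: subset_seqDU.
apply: lee_nneseries => [n _ _|n _]; last exact: (PG n).2.
by apply: esum_ge0.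
Qed.

HB.instance Definition _ := isOuterMeasure.Build R 'rV[R]_d mu
  lebesgue_outer0 lebesgue_outer_ge0 le_lebesgue_outer
  lebesgue_outer_sigma_subadditive.

End lebesgue_outer_measure.

(* R^d with the sigma-algebra of its Lebesgue measurable sets. *)
Notation lebesgue_rV R d := (caratheodory_type (@lebesgue_outer R d)).

Record topological_dual (R : realType) (V : normedModType R) := Dual {
  dual_fun :> {linear V -> R^o};
  dual_continuous : continuous dual_fun }.

(* Only the values of f on Omega matter. The premise [measurable Omega] built
   into measurable_fun always holds when Omega is open. *)
Definition lebesgue_measurable_fun (R : realType) (d : nat)
    (Omega : set 'rV[R]_d) (f : 'rV[R]_d -> R) : Prop :=
  measurable_fun (Omega : set (lebesgue_rV R d)) (f : lebesgue_rV R d -> R).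

Definition weakly_measurable (R : realType) (d : nat) (V : normedModType R)
    (Omega : set 'rV[R]_d) (u : 'rV[R]_d -> V) : Prop :=
  forall q : topological_dual V, lebesgue_measurable_fun Omega (fun x => q (u x)).

Definition weakly_star_continuous (R : realType) (d : nat)
    (V : normedModType R) (Omega : set 'rV[R]_d)
    (p : 'rV[R]_d -> topological_dual V) : Prop :=
  forall v : V, {within Omega, continuous (fun x => p x v : R)}.

(* Main.v *)
(* [F z x = <p z, u x>] is a Caratheodory function: measurable in [x] for fixed
   [z], continuous in [z] for fixed [x]. Rounding [x] to a point [z_n x] of the
   grid of mesh [1 / (n + 1)] gives [F (z_n x) x --> F x x], and each
   [F (z_n x) x] is measurable because [z_n] takes countably many values, on
   half-open cubes. Cubes are Lebesgue measurable because cutting a box along a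
   coordinate hyperplane preserves its total volume. *)
Require Import Defs.
From mathcomp Require Import all_boot all_order all_algebra.
From mathcomp Require Import all_classical all_reals all_analysis.
From mathcomp Require Import measurable_realfun lra.
Import Order.TTheory GRing.Theory Num.Theory.
Import numFieldNormedType.Exports.
Local Open Scope classical_set_scope.
Local Open Scope ring_scope.

Lemma le_esum_subset (R : realType) (T : choiceType) (A B : set T)
    (a : T -> \bar R) :
  (forall i, 0 <= a i)%E -> A `<=` B ->
  (\esum_(i in A) a i <= \esum_(i in B) a i)%E.
Proof.
move=> a0 AB; rewrite [leRHS](esumID A)// (setIidr AB) leeDl//.
by apply: esum_ge0 => i _.
Qed.

(** Indices with equal images count several times on the right but once on the left: a section [g]
    of [e] embeds the image into [P]. *)
Lemma le_esum_image (R : realType) (T T' : choiceType) (P : set T)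
    (e : T -> T') (a : T' -> \bar R) :
  (forall i, 0 <= a i)%E ->
  (\esum_(j in e @` P) a j <= \esum_(i in P) a (e i))%E.
Proof.
move=> a0.
(* The point [i0] is the default value of [g] outside the image. *)
have [->|/set0P[i0 _]] := eqVneq P set0; first by rewrite image_set0 !esum_set0.
have /choice[g gP] : forall j, exists i, (e @` P) j -> P i /\ e i = j.
  by move=> j; have [[i Pi <-]|nj] := pselect ((e @` P) j);
    [exists i|exists i0].
have -> : \esum_(j in e @` P) a j = \esum_(j in e @` P) a (e (g j)).
  by apply: eq_esum => j /gP[_ ->].
rewrite -(esum_image (e @` P) g (a \o e)).
  apply: le_esum_subset => [i|]; first exact: a0.
  by move=> _ [j /gP[Pj _] <-].
by move=> j k /set_mem/gP[_ {2}<-] /set_mem/gP[_ {2}<-] ->.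
Qed.

Section halfspace.
Context (R : realType) (d : nat).
Implicit Types (c : 'rV[R]_d * 'rV[R]_d) (i : 'I_d) (t : R).

(** The minimum here and the maximum in [box_gt] allow any [t]: if it lies outside the edge, one
    piece is empty. *)
Definition box_le i t c : 'rV[R]_d * 'rV[R]_d :=
  (c.1, \row_j if j == i then Num.min (c.2 ord0 j) t else c.2 ord0 j).

Definition box_gt i t c : 'rV[R]_d * 'rV[R]_d :=
  (\row_j if j == i then Num.max (c.1 ord0 j) t else c.1 ord0 j, c.2).

Lemma box_setI_le i t c :
  box c `&` [set x | x ord0 i <= t] `<=` box (box_le i t c).
Proof.
move=> x [cx xt] j; have := cx j; rewrite !in_itv /= mxE => /andP[-> xj] /=.
by case: eqP => // ji; rewrite le_min xj ji.
Qed.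

Lemma box_setD_le i t c :
  box c `&` ~` [set x | x ord0 i <= t] `<=` box (box_gt i t c).
Proof.
move=> x [cx /negP]; rewrite -ltNge => xt j.
have := cx j; rewrite !in_itv /= mxE => /andP[xj ->]; rewrite andbT.
by case: eqP => // ji; rewrite gt_max xj ji.
Qed.

(** Only factor [i] of the product changes, and the length of []a, b]] is the sum of those of its
    parts below and above [t], empty intervals having length 0. *)
Lemma box_volume_cut i t c :
  box_volume c = box_volume (box_le i t c) + box_volume (box_gt i t c).
Proof.
rewrite /box_volume (bigD1 i)//= [X in _ = X + _](bigD1 i)//=.
rewrite [X in _ = _ + X](bigD1 i)//= !mxE eqxx.
under [X in _ = _ * X + _]eq_bigr => j /negPf ji do rewrite mxE ji.
under [X in _ = _ + _ * X]eq_bigr => j /negPf ji do rewrite mxE ji.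
rewrite -mulrDl; congr (_ * _).
move: (c.1 ord0 i) (c.2 ord0 i) => a b.
by case: (leP b t); case: (leP a t) => ? ?; do ?case: leP => ? ; lra.
Qed.

(** Allows covers given as indexed families: distinct boxes may have the same piece after a cut, and
    repetitions only enlarge the sum. *)
Lemma lebesgue_outer_le_esum (I : choiceType) (D : set I)
    (b : I -> 'rV[R]_d * 'rV[R]_d) (A : set 'rV[R]_d) :
  countable D -> A `<=` \bigcup_(k in D) box (b k) ->
  (lebesgue_outer A <= \esum_(k in D) (box_volume (b k))%:E)%E.
Proof.
move=> cD AD; apply: (@le_trans _ _ (\esum_(c in b @` D) (box_volume c)%:E)%E).
  apply: ereal_inf_lbound; exists (b @` D) => //; split.
    exact: sub_countable (card_image_le _ _) cD.
  by rewrite bigcup_image.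
by apply: le_esum_image => c; rewrite lee_fin box_volume_ge0.
Qed.

Lemma measurable_coord_le i t :
  measurable ([set x : 'rV[R]_d | x ord0 i <= t] : set (lebesgue_rV R d)).
Proof.
apply: le_caratheodory_measurable => X.
apply: le_ereal_inf_tmp => _ [C [cC XC] <-].
have vol0 c : (0 <= (box_volume c)%:E)%E by rewrite lee_fin box_volume_ge0.
(* Every box of the cover [C] of [X] is cut in two; the lower pieces cover the part of [X] in the
   half-space, the upper ones the rest. *)
under eq_esum do rewrite (box_volume_cut i t) EFinD.
rewrite esumD//; apply: leeD; apply: lebesgue_outer_le_esum => //.
  move=> x [/XC[c Cc cx] xt]; exists c => //.
  by apply: box_setI_le.
move=> x [/XC[c Cc cx] xt]; exists c => //.
by apply: box_setD_le.
Qed.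

Lemma measurable_coord_itv i (a b : R) :
  measurable ([set x : 'rV[R]_d | x ord0 i \in `]a, b]] : set (lebesgue_rV R d)).
Proof.
have -> : [set x : 'rV[R]_d | x ord0 i \in `]a, b]] =
    [set x : 'rV[R]_d | x ord0 i <= b] `\` [set x : 'rV[R]_d | x ord0 i <= a].
  apply/seteqP; split=> x /=; rewrite in_itv/= ltNge.
    by case/andP=> /negP.
  by case=> -> /negP ->.
by apply: measurableD; exact: measurable_coord_le.
Qed.

End halfspace.

Section grid.
Context (R : realType) (d : nat).

(** Rounding up makes the fibres cubes of the same half-open shape []a, b]] as the boxes. *)
Definition grid_index (n : nat) (x : 'rV[R]_d) : 'rV[int]_d :=
  \row_i Num.ceil (n.+1%:R * x ord0 i).

Definition grid_point (n : nat) (k : 'rV[int]_d) : 'rV[R]_d :=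
  \row_i ((k ord0 i)%:~R / n.+1%:R).

Lemma measurable_grid_index n k :
  measurable ([set x : 'rV[R]_d | grid_index n x = k] : set (lebesgue_rV R d)).
Proof.
have -> : [set x | grid_index n x = k] = \bigcap_i [set x : 'rV[R]_d |
    x ord0 i \in `](k ord0 i - 1)%:~R / n.+1%:R, (k ord0 i)%:~R / n.+1%:R]].
  apply/seteqP; split=> x /=.
    move=> <- i _ /=; rewrite in_itv/= mxE.
    by rewrite ltr_pdivrMr// ler_pdivlMr// ![_ * n.+1%:R]mulrC ceil_itv.
  move=> xk; apply/rowP => i; rewrite mxE; apply/eqP; rewrite ceil_eq.
  have := xk i I; rewrite /= in_itv/=.
  by rewrite ltr_pdivrMr// ler_pdivlMr// ![_ * n.+1%:R]mulrC.
by apply: fin_bigcap_measurable => // i _; exact: measurable_coord_itv.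
Qed.

Lemma grid_point_cvg (x : 'rV[R]_d) :
  grid_point n (grid_index n x) @[n --> \oo] --> x.
Proof.
apply/cvg_ballP => e e0; near=> n; split=> // i j; rewrite !mxE ord1.
have n0 : 0 < n.+1%:R :> R by [].
have ne : n.+1%:R^-1 < e by near: n; exact: (near_infty_natSinv_lt (PosNum e0)).
(* Rounding up raises each coordinate by less than one mesh width. *)
have /andP[] := ceil_itv (n.+1%:R * x ord0 j).
rewrite intrD /= => xl xr.
rewrite /ball /= distrC ger0_norm; last first.
  by rewrite subr_ge0 ler_pdivlMr// mulrC.
apply: lt_trans ne.
rewrite ltrBlDr ltr_pdivrMr// mulrDl mulVf ?gt_eqF// [x _ _ * _]mulrC.
by rewrite -ltrBlDl.
Unshelve. all: by end_near. Qed.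

End grid.
Arguments grid_index {R d}.
Arguments grid_point {R d}.

Lemma lebesgue_measurable_fun_diagonal (R : realType) (d : nat)
    (Omega : set 'rV[R]_d) (F : 'rV[R]_d -> 'rV[R]_d -> R) :
  open Omega ->
  (forall z, lebesgue_measurable_fun Omega (F z)) ->
  (forall y, {within Omega, continuous (F ^~ y)}) ->
  lebesgue_measurable_fun Omega (fun x => F x x).
Proof.
move=> oO mF cF.
apply: (@measurable_fun_cvg _ (lebesgue_rV R d) R Omega
  (fun n x => F (grid_point n (grid_index n x)) x)); last first.
  move=> x Ox.
  (* Grid points near [x] may lie outside [Omega]; openness gives continuity at [x] in the whole
     space. *)
  have Fx : {for x, continuous (F ^~ x)}.
    by have := cF x; rewrite continuous_open_subspace// => /(_ x (mem_set Ox)).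
  apply: (@continuous_cvg nat 'rV[R]_d R _ _ _ (F ^~ x) x Fx).
  exact: grid_point_cvg.
move=> n mO B mB.
(* On each of the countably many cells, the first argument of [F] is constant. *)
have -> : Omega `&` (fun x => F (grid_point n (grid_index n x)) x) @^-1` B =
    \bigcup_k ([set x | grid_index n x = k] `&`
      (Omega `&` F (grid_point n k) @^-1` B)).
  apply/seteqP; split=> x /=; first by move=> [Ox Bx]; exists (grid_index n x).
  by move=> [k _ [<- [Ox Bx]]].
apply: countable_bigcupT_measurable => // k.
by apply: measurableI; [exact: measurable_grid_index|exact: mF].
Qed.

Theorem lemma1 (R : realType) (d : nat) (V : completeNormedModType R)
    (Omega : set 'rV[R]_d) (u : 'rV[R]_d -> V)
    (p : 'rV[R]_d -> topological_dual V)
    (Omega_open : open Omega) (Omega_bounded : bounded_set Omega)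
    (u_measurable : weakly_measurable Omega u)
    (p_continuous : weakly_star_continuous Omega p) :
  lebesgue_measurable_fun Omega (fun x => p x (u x)).
Proof.
(* For fixed [z], [p z] is a single functional to test [u] with; for fixed [y], [u y] is a single
   vector to test [p] with. *)
by apply: (@lebesgue_measurable_fun_diagonal _ _ _ (fun z x => p z (u x))).
Qed.
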